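(* Let $Z_0,Z_1,Z_2,\ldots$ be independent random variables with values in $\mathbb N$, where $Z_1,Z_2,\ldots$ are identically distributed with finite mean $\mu$ and $\mathrm P(Z_0=n)=\mathrm P(Z_1\ge n)/\mu$ for $n\in\mathbb N$. Let $Y=\{Z_0,\,Z_0+Z_1,\,Z_0+Z_1+Z_2,\ldots\}$ (a stationary delayed renewal process), let $X_n=1_Y(n)$ for $n\in\mathbb N$, and let $F$ be the cumulative distribution function of $X=\sum_{n=1}^\infty X_n2^{-n}$. Then: (I) If $Z_1$ is geometrically distributed with mean $2$, then $F$ is the uniform CDF on $[0,1]$. (II) If $Z_1$ is degenerate, i.e. $\mathrm P(Z_1=k)=1$ for some $k\in\mathbb N$, then $F$ is the CDF of the uniform distribution on the set $\{2^{-\ell}/(1-2^{-k})\mid \ell\in\{1,\ldots,k\}\}$. (III) Otherwise (in neither of the cases (I), (II)), $F$ is singular continuous. Moreover: (IV) $F$ is strictly increasing on $[0,1]$ if and only if $\mathrm P(Z_1=n)>0$ for all $n\in\mathbb N$.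
   Context: $\mathbb N=\{1,2,\ldots\}$; $1_Y(n)=1$ if $n\in Y$ and $0$ otherwise. The CDF is $F(x)=\mathrm P(X\le x)$, $x\in\mathbb R$. The uniform CDF on $[0,1]$ is the CDF with value $x$ at each $x\in[0,1]$. ''Geometrically distributed with mean $2$'' means $\mathrm P(Z_1=n)=2^{-n}$ for $n\in\mathbb N$. A function $F:\mathbb R\to\mathbb R$ is singular if $F'(x)$ exists and equals $0$ for Lebesgue almost every $x\in\mathbb R$; it is singular continuous if it is both singular and continuous. *)

(* Defs.v *)
From HB Require Import structures.
From mathcomp Require Import all_boot all_order all_algebra finmap.
From mathcomp Require Import all_classical all_reals all_analysis.
From mathcomp Require Import measurable_realfun lra.
Set Implicit Arguments.
Unset Strict Implicit.
Unset Printing Implicit Defensive.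
Import Order.TTheory GRing.Theory Num.Theory.
Import numFieldNormedType.Exports.

Local Open Scope classical_set_scope.
Local Open Scope fset_scope.
Local Open Scope ring_scope.

(** Mutual independence: the product rule over every finite subfamily. *)
Definition mutually_independent d d' (T : measurableType d)
    (T' : measurableType d') (R : realType) (P : probability T R)
    (I : choiceType) (Z : I -> {RV P >-> T'}) :=
  forall (J : {fset I}) (A : I -> set T'),
    (forall i, measurable (A i)) ->
    P (\bigcap_(i in [set` J]) (Z i @^-1` A i)) =
    (\prod_(i <- J) P (Z i @^-1` A i))%E.

Definition identically_distributed d d' (T : measurableType d)
    (T' : measurableType d') (R : realType) (P : probability T R)
    (Z Z' : {RV P >-> T'}) :=
  forall A : set T', measurable A -> distribution P Z A = distribution P Z' A.

Section renewal.
Context d (T : measurableType d).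

Definition renewal_set (Z : nat -> T -> nat) (t : T) : set nat :=
  range (fun m => \sum_(0 <= i < m.+1) Z i t)%N.

Variable R : realType.

Definition renewal_digit (Z : nat -> T -> nat) (n : nat) (t : T) : R :=
  \1_(renewal_set Z t) n.

Definition renewal_number (Z : nat -> {mfun T >-> nat}) (t : T) : R :=
  \big[+%R/0]_(1 <= n <oo) (renewal_digit Z n t * 2 ^- n).

Lemma measurable_renewal_digit (Z : nat -> {mfun T >-> nat}) n :
  measurable_fun [set: T] (renewal_digit Z n).
Proof.
rewrite (_ : renewal_digit Z n =
  \1_(\bigcup_m ((fun t => \sum_(0 <= i < m.+1) Z i t)%N @^-1` [set n]))).
  apply: measurable_indic; apply: bigcup_measurable => m _.
  rewrite -[X in measurable X]setTI.
  suff mS k : measurable_fun [set: T] (fun t => \sum_(0 <= i < k) Z i t)%N.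
    exact: mS.
  elim: k => [|k IH].
    by under eq_fun do rewrite big_nil; exact: measurable_cst.
  under eq_fun do rewrite big_nat_recr//=.
  by apply: measurable_fun_addn => //; exact: measurable_funP.
by apply/funext => t; rewrite /renewal_digit !indicE; congr (_%:R).
Qed.

Lemma cvg_renewal_number (Z : nat -> {mfun T >-> nat}) t :
  (fun N => \sum_(1 <= n < N) renewal_digit Z n t * 2 ^- n : R) @ \oo
    --> renewal_number Z t.
Proof.
have d0 n : 0 <= renewal_digit Z n t * 2 ^- n.
  by rewrite mulr_ge0// /renewal_digit indicE.
apply: nondecreasing_is_cvgn.
  apply/nondecreasing_seqP => -[|n]; first by rewrite !big_geq.
  by rewrite [leRHS]big_nat_recr//= lerDl.
exists 1 => _ [N _ <-].
case: N => [|N]; first by rewrite big_geq.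
apply: (@le_trans _ _ (1 - 2 ^- N)); last by rewrite gerBl invr_ge0 exprn_ge0.
elim: N => [|N IH]; first by rewrite big_geq// expr0 invr1 subrr.
rewrite big_nat_recr//= (le_trans (lerD IH (_ : _ <= 2 ^- N.+1)))//.
  by rewrite ler_piMl// /renewal_digit indicE lern1 leq_b1.
rewrite exprS invfM -addrA lerD2l.
by have := splitr (2 ^- N : R); lra.
Qed.

Lemma measurable_renewal_number (Z : nat -> {mfun T >-> nat}) :
  measurable_fun [set: T] (renewal_number Z).
Proof.
apply: (@measurable_fun_cvg _ _ _ _
  (fun N t => \sum_(1 <= n < N) renewal_digit Z n t * 2 ^- n)).
  move=> N; apply: measurable_sum => n.
  by apply: measurable_funM => //; exact: measurable_renewal_digit.
by move=> t _; exact: cvg_renewal_number.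
Qed.

HB.instance Definition _ (Z : nat -> {mfun T >-> nat}) :=
  isMeasurableFun.Build _ _ _ _ (renewal_number Z)
    (measurable_renewal_number Z).

End renewal.

(** The real-valued cumulative distribution function of
    $\sum_{n \ge 1} 1_Y(n) 2^{-n}$; the library's [cdf] takes values in
    [\bar R]. *)
Definition renewal_cdf d (T : measurableType d) (R : realType)
    (P : probability T R) (Z : nat -> {RV P >-> nat}) (x : R) : R :=
  fine (cdf (renewal_number R Z : {RV P >-> R}) x).

Definition uniform01_cdf (R : realType) (x : R) : R :=
  if x < 0 then 0 else if x <= 1 then x else 1.

Definition uniform_fset_cdf (R : realType) (S : {fset R}) (x : R) : R :=
  #|` [fset y in S | y <= x]|%:R / #|` S|%:R.

Definition geometric_mean2 d (T : measurableType d) (R : realType)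
    (P : probability T R) (Z : {RV P >-> nat}) :=
  forall n, (0 < n)%N -> P (Z @^-1` [set n]) = (2 ^- n)%:E.

Definition singular (R : realType) (F : R -> R) :=
  {ae @lebesgue_measure R, forall x, derivable F x 1 /\ derive1 F x = 0}.

Definition singular_continuous (R : realType) (F : R -> R) :=
  singular F /\ continuous F.

(* Main.v *)
(** Let f be the law of Z_1. The mass of a dyadic cell is an explicit product
    over the gaps between ones in its binary word, and F is studied through
    these masses only.

    Continuity: if no gap value has probability 1, then f <= c < 1, and a long
    word either contains many complete gaps or a long run of zeros, so the mass
    of the largest cell tends to 0.

    Singularity: let H_n be the sum over the cells I of level n of
    sqrt (|I| F(I)). Decomposing words at their ones bounds sum_n H_n by a
    geometric series of ratio G = sum_k sqrt (2^-k f(k)), and G < 1 by AM-GM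
    unless f is geometric. By Markov's inequality the cells with
    F(I) > e |I| have total length at most H_n / sqrt e, so by Borel-Cantelli
    almost every x is eventually at distance at least 2^-n from all of them,
    and the difference quotients of F at x tend to 0. *)
Require Import Defs.
From mathcomp Require Import all_boot all_order all_algebra finmap.
From mathcomp Require Import all_classical all_reals all_analysis.
From mathcomp Require Import ring lra zify.
Set Implicit Arguments.
Unset Strict Implicit.
Unset Printing Implicit Defensive.
Import Order.TTheory GRing.Theory Num.Theory.
Import numFieldNormedType.Exports.

Local Open Scope classical_set_scope.
Local Open Scope fset_scope.
Local Open Scope ring_scope.

(** * Monotone functions and their dyadic increments *)

Lemma expV2_lt {R : realType} (a : R) : 0 < a -> exists n, 2 ^- n < a.
Proof.
move=> a_gt0; have /cvgrPdist_lt /(_ _ a_gt0) [n _ Hn] :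
    2^-1 ^+ n @[n --> \oo] --> (0 : R).
  by apply: cvg_expr; rewrite ger0_norm; lra.
exists n; have := Hn n (leqnn n).
by rewrite /= sub0r normrN exprVn; apply: le_lt_trans; exact: ler_norm.
Qed.

Lemma eq0_le_expV2 {R : realType} (a : R) : (forall n, `|a| <= 2 ^- n) -> a = 0.
Proof.
move=> a_le; apply/eqP; rewrite -normr_le0 leNgt; apply/negP => a_gt0.
by have [n] := expV2_lt a_gt0; rewrite ltNge a_le.
Qed.

Section dyadic_increments.
Context {R : realType}.
Variable F : R -> R.
Hypothesis F_homo : {homo F : x y / x <= y}.
Hypothesis F_le0 : forall x, x <= 0 -> F x = 0.
Hypothesis F_ge1 : forall x, 1 <= x -> F x = 1.

Definition dyadic_increment n (k : nat) : R :=
  F (k.+1%:R * 2 ^- n) - F (k%:R * 2 ^- n).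

(** Both [x] and [x + h] lie in a block of three consecutive cells around [x], each contributing at
    most [B]. Only cells within one cell length of [x] are constrained, so that the bound can be
    used at a single point that avoids the bad cells. *)
Lemma increment_le x h n B : `|h| <= 2 ^- n -> 0 <= B ->
  (forall k, (k < 2 ^ n)%N -> (k%:R - 1) * 2 ^- n <= x <= (k%:R + 2) * 2 ^- n ->
    dyadic_increment n k <= B) ->
  `|F (x + h) - F x| <= 3 * B.
Proof.
move=> hn B_ge0 cB.
have e_gt0 : 0 < 2 ^+ n :> R by rewrite exprn_gt0.
have ev_gt0 : 0 < 2 ^- n :> R by rewrite invr_gt0.
pose m := Num.floor (x * 2 ^+ n).
have /andP[] := floor_itv (x * 2 ^+ n); rewrite -/m intrD mulr1z => mx xm.
(* [F] is constant on either side of [0, 1], so cells with negative index or index at least 2^n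
   contribute nothing. *)
have dB (i : int) : m%:~R - 1 <= (i%:~R : R) <= m%:~R + 1 ->
    F ((i%:~R + 1) * 2 ^- n) - F (i%:~R * 2 ^- n) <= B.
  move=> /andP[mi im].
  have [i_lt0|i_ge0] := ltP i 0.
    have : i%:~R + 1 <= 0 :> R by rewrite -(intrD R _ 1) lerz0; lia.
    by move=> i1; rewrite !F_le0 ?subrr// pmulr_lle0//; lra.
  case: i i_ge0 mi im => // k _ mi im; rewrite -!pmulrn in mi im *.
  have [kn|nk] := ltnP k (2 ^ n)%N; last first.
    have : 2 ^+ n <= k%:R :> R by rewrite -natrX ler_nat.
    by move=> h1; rewrite !F_ge1 ?subrr// ler_pdivlMr ?mul1r//; lra.
  rewrite natr1; apply: cB => //.
  by rewrite ler_pdivrMr// ler_pdivlMr//; apply/andP; split; lra.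
have mx' : m%:~R * 2 ^- n <= x by rewrite ler_pdivrMr.
have xm' : x < (m%:~R + 1) * 2 ^- n by rewrite ltr_pdivlMr.
have hx : (m%:~R - 1) * 2 ^- n <= x + h <= (m%:~R + 2) * 2 ^- n.
  by move: hn; rewrite ler_norml => /andP[h1 h2]; apply/andP; split; lra.
have xx : (m%:~R - 1) * 2 ^- n <= x <= (m%:~R + 2) * 2 ^- n.
  by apply/andP; split; lra.
have d1 := dB (m - 1); have d2 := dB m; have d3 := dB (m + 1).
rewrite !(intrD, intrB) in d1 d2 d3.
have {}d1 := d1 ltac:(apply/andP; split; lra).
have {}d2 := d2 ltac:(apply/andP; split; lra).
have {}d3 := d3 ltac:(apply/andP; split; lra).
rewrite subrK in d1; rewrite -addrA in d3.
move: hx xx => /andP[/F_homo a1 /F_homo a2] /andP[/F_homo b1 /F_homo b2].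
by rewrite ler_norml; apply/andP; split; lra.
Qed.

Lemma continuous_of_increments :
  (forall e, 0 < e ->
    exists n, forall k, (k < 2 ^ n)%N -> dyadic_increment n k <= e) ->
  continuous F.
Proof.
move=> small x; apply/cvgrPdist_le => e e_gt0.
have [n Hn] := small (e / 3) ltac:(by rewrite divr_gt0).
have ev_gt0 : 0 < 2 ^- n :> R by rewrite invr_gt0 exprn_gt0.
near=> y; rewrite distrC -[y](subrKC x) (_ : e = 3 * (e / 3)); last by field.
apply: (@increment_le _ _ n) => [|| k kn _]; last exact: Hn.
- by rewrite distrC; near: y; exact: cvgr_dist_le.
- by rewrite divr_ge0// ltW.
Unshelve. all: by end_near. Qed.

(** Take the least [n] with 2^-n < 2a; for n > 0 minimality gives a <= 2^-n. This selects the level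
    of cells comparable with an increment of length [a]. *)
Lemma dyadic_scale (a : R) N : 0 < a <= 2 ^- N ->
  exists n, [/\ (N <= n)%N, a <= 2 ^- n & 2 ^- n < 2 * a].
Proof.
move=> /andP[a_gt0 aN].
have [M aM] := expV2_lt a_gt0.
have exn : exists n, (2 ^- n < 2 * a) by exists M; lra.
have mono (i j : nat) : (i <= j)%N -> 2 ^- j <= 2 ^- i :> R.
  by move=> ij; rewrite lef_pV2 ?posrE ?exprn_gt0// ler_weXn2l// ler1n.
case: (ex_minnP exn) => n na nmin; exists n; split => //.
  rewrite leqNgt; apply/negP => /mono; move: na; rewrite exprS invfM; lra.
case: n na nmin => [|n] na nmin; first exact: le_trans aN (mono _ _ (leq0n N)).
have : 2 * a <= 2 ^- n by rewrite leNgt; apply/negP => /nmin; rewrite ltnn.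
by rewrite exprS invfM; lra.
Qed.

Lemma singular_of_increments (C : R) :
  (forall N, \sum_(0 <= n < N) \sum_(0 <= k < 2 ^ n)
    Num.sqrt (2 ^- n * dyadic_increment n k) <= C) ->
  singular F.
Proof.
move=> sumC.
pose bad e n k := e * 2 ^- n < dyadic_increment n k.
(* The cell enlarged by one cell length on each side, matching the hypothesis of [increment_le]. *)
pose near_cell n k : set R :=
  `[(k%:R - 1) * 2 ^- n, (k%:R + 2) * 2 ^- n]%classic.
pose V e n := \big[setU/set0]_(k < 2 ^ n)
  (if bad e n k then near_cell n k else set0).
have mV e n k : measurable (if bad e n k then near_cell n k else set0).
  by case: ifP => _ //; exact: measurable_itv.
have VE e n : 0 < e -> (lebesgue_measure (V e n) <= (3 / Num.sqrt e *
    \sum_(0 <= k < 2 ^ n) Num.sqrt (2 ^- n * dyadic_increment n k))%:E)%E.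
  move=> e_gt0; have ev_gt0 : 0 < 2 ^- n :> R by rewrite invr_gt0 exprn_gt0.
  rewrite /V; apply: (le_trans (@Boole_inequality _ _ _ lebesgue_measure
    (fun k => if bad e n k then near_cell n k else set0) (2 ^ n)%N _)).
    by move=> k _; exact: mV.
  rewrite mulr_sumr -sumEFin big_mkord; apply: lee_sum => k _.
  case: ifPn => [|_]; last first.
    by rewrite measure0 lee_fin mulr_ge0 ?divr_ge0 ?sqrtr_ge0.
  (* Markov's inequality for one cell: e 2^-n < increment gives sqrt(e) 2^-n <= sqrt(2^-n
     increment). The factor 3 comes from the enlargement. *)
  rewrite /bad => e_lt; rewrite [leLHS](_ : _ = (3 * 2 ^- n)%:E).
    rewrite lee_fin.
    rewrite -[3 / _ * _]mulrA ler_pM2l// mulrC ler_pdivlMr ?sqrtr_gt0//.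
    rewrite -[X in X * _](ger0_norm (ltW ev_gt0)) -sqrtr_sqr.
    rewrite -sqrtrM ?sqr_ge0// ler_wsqrtr// expr2 -mulrA ler_pM2l//.
    by rewrite mulrC ltW.
  rewrite /near_cell; etransitivity; first exact: lebesgue_measure_itv.
  rewrite /= lte_fin ltr_pM2r// ifT; last by lra.
  by rewrite -EFinD -mulrBl; congr (_ * _)%:E; lra.
have null e : 0 < e -> lebesgue_measure (lim_sup_set (V e)) = 0%E.
  move=> e_gt0; apply: lim_sup_set_cvg0.
    by move=> n; apply: bigsetU_measurable => k _; exact: mV.
  apply: (@le_lt_trans _ _ (3 / Num.sqrt e * C)%:E); last exact: ltry.
  apply: lime_le; first exact: is_cvg_nneseries.
  apply: nearW => N; apply: (@le_trans _ _ (\sum_(0 <= n < N) (3 / Num.sqrt e *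
      \sum_(0 <= k < 2 ^ n) Num.sqrt (2 ^- n * dyadic_increment n k))%:E)%E).
    by apply: lee_sum => n _; exact: VE.
  rewrite sumEFin lee_fin -mulr_sumr ler_wpM2l// divr_ge0// sqrtr_ge0.
(* The thresholds 1/(m+1) serve every e > 0 and keep the exceptional set a countable union of null
   sets. *)
have : (@lebesgue_measure R).-negligible
    (\bigcup_m lim_sup_set (V m.+1%:R^-1)).
  apply: negligible_bigcup => m.
  exists (lim_sup_set (V m.+1%:R^-1)); split=> //.
    apply: bigcap_measurable; first by exists 0%N.
    move=> n _; apply: bigcup_measurable => j _.
    by apply: bigsetU_measurable => k _; exact: mV.
  by apply: null; rewrite invr_gt0.
apply: negligibleS => x /= nx; apply: contrapT => xV; apply: nx.
suff : h^-1 *: (F (h *: 1 + x) - F x) @[h --> 0^'] --> (0 : R).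
  move=> cv; split; first by apply/cvg_ex; exists 0.
  by rewrite derive1E; exact: (cvg_lim _ cv).
apply/cvgrPdist_le => e e_gt0.
(* Here 6 = 3 * 2: three cells in [increment_le], and 2^-n < 2|h| from [dyadic_scale]. *)
pose m := Num.truncn (6 / e).
have me : 6 * m.+1%:R^-1 <= e.
  by rewrite ler_pdivrMr// mulrC -ler_pdivrMr// ltW// truncnS_gt.
have [N HN] : exists N, forall n, (N <= n)%N -> ~ V m.+1%:R^-1 n x.
  apply: contrapT => noN; apply: xV; exists m => // n _.
  apply: contrapT => nV; apply: noN; exists n => j nj Vj; apply: nV.
  by exists j.
near=> h.
have h0 : h != 0 by near: h; exact: nbhs_dnbhs_neq.
have hN : `|h| <= 2 ^- N.
  near: h; apply: dnbhs0_le; rewrite invr_gt0 exprn_gt0//.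
have [n [Nn hn nh]] := @dyadic_scale `|h| N ltac:(by rewrite normr_gt0 h0).
rewrite sub0r normrN normrZ normfV mulrC ler_pdivrMr ?normr_gt0//.
rewrite scaler1 [h + x]addrC.
have m0 : 0 < m.+1%:R^-1 :> R by rewrite invr_gt0.
apply: (le_trans (@increment_le x h n (m.+1%:R^-1 * 2 ^- n) hn _ _)).
- by rewrite mulr_ge0 ?ltW// invr_gt0 exprn_gt0.
- move=> k kn xk; rewrite leNgt; apply/negP => b; apply: (HN _ Nn).
  rewrite /V -(bigcup_mkord _ (fun k => if bad _ n k then _ n k else set0)).
  by exists k => //; rewrite /bad b /near_cell /= in_itv.
have := ler_wpM2r (normr_ge0 h) me.
have : m.+1%:R^-1 * 2 ^- n <= m.+1%:R^-1 * (2 * `|h|).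
  by rewrite ler_pM2l// ltW.
by move: (m.+1%:R^-1) (2 ^- n) => a b; lra.
Unshelve. all: by end_near. Qed.

(** Summing increments makes [F] the identity at dyadic points of [0, 1]; monotonicity then gives
    |F(x) - x| <= 2^-n for every [n]. *)
Lemma uniform_of_increments :
  (forall n k, (k < 2 ^ n)%N -> dyadic_increment n k = 2 ^- n) ->
  F = @uniform01_cdf R.
Proof.
move=> incE.
have FE n k : (k <= 2 ^ n)%N -> F (k%:R * 2 ^- n) = k%:R * 2 ^- n.
  elim: k => [|k IH] kn; first by rewrite mul0r F_le0.
  have := incE n k kn; rewrite /dyadic_increment (IH (ltnW kn)) => /eqP.
  by rewrite subr_eq => /eqP ->; rewrite -natr1; ring.
apply/funext => x; rewrite /uniform01_cdf; case: ifPn => [/ltW/F_le0//|].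
rewrite -leNgt => x_ge0; case: ifPn => [x_le1|]; last first.
  by rewrite -ltNge => /ltW/F_ge1.
(* At x = 1 the index [k] below would be 2^n, which is not a cell of [0, 1]. *)
have [->|x_neq1] := eqVneq x 1; first exact: F_ge1.
apply/eqP; rewrite -subr_eq0; apply/eqP/eq0_le_expV2 => n.
have e_gt0 : 0 < 2 ^+ n :> R by rewrite exprn_gt0.
pose k := Num.truncn (x * 2 ^+ n).
have /andP[kx xk] : k%:R <= x * 2 ^+ n < k.+1%:R.
  by apply: truncn_itv; rewrite mulr_ge0// ltW.
have kn : (k < 2 ^ n)%N.
  rewrite -(ltr_nat R) natrX (le_lt_trans kx)// gtr_pMl//.
  by rewrite lt_neqAle x_neq1.
move: kx xk; rewrite -ler_pdivrMr// -ltr_pdivlMr// => kx /ltW xk.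
have := F_homo kx; have := F_homo xk.
rewrite (FE _ _ kn) (FE _ _ (ltnW kn)) => h1 h2.
move: xk h1; rewrite -natr1 => xk h1.
by rewrite ler_norml; apply/andP; split; lra.
Qed.

(** As soon as 2^-n < (y - x)/2, a complete cell of level [n] fits between [x] and [y]. *)
Lemma increasing_of_increments :
  (forall n k, (k < 2 ^ n)%N -> 0 < dyadic_increment n k) ->
  {in `[0, 1] &, {homo F : x y / x < y}}.
Proof.
move=> inc_gt0 x y; rewrite !in_itv/= => /andP[x_ge0 _] /andP[_ y_le1] xy.
have [n hn] := @expV2_lt R ((y - x) / 2) ltac:(by rewrite divr_gt0// subr_gt0).
have e_gt0 : 0 < 2 ^+ n :> R by rewrite exprn_gt0.
pose m := Num.truncn (x * 2 ^+ n).
have /andP[] : m%:R <= x * 2 ^+ n < m.+1%:R.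
  by apply: truncn_itv; rewrite mulr_ge0// ltW.
rewrite -ler_pdivrMr// -ltr_pdivlMr// => mx xm.
have my : m.+2%:R * 2 ^- n <= y by rewrite -natr1 -[m.+1%:R]natr1; lra.
have mn : (m.+1 < 2 ^ n)%N.
  rewrite -(ler_nat R) natrX -[leRHS]mul1r -ler_pdivrMr//.
  exact: le_trans y_le1.
rewrite (le_lt_trans (F_homo (ltW xm)))// (lt_le_trans _ (F_homo my))//.
by have := inc_gt0 _ _ mn; rewrite subr_gt0.
Qed.

End dyadic_increments.

(** * Masses of the dyadic cells *)

Section cells.
Context {R : realType}.
Implicit Types (f p : nat -> R) (j n k : nat).

(** For a probability law on the positive integers this is the probability of a gap longer than [j],
    written with a finite sum. *)
Definition tail p j : R := 1 - \sum_(1 <= i < j.+1) p i.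

(** The mass of the positive integers is at most 1; that no mass is lost is expressed separately, by
    convergence of [tail p] to 0. *)
Definition gap_law p := (forall n, 0 <= p n) /\ (forall j, 0 <= tail p j).

Lemma tail0 p : tail p 0 = 1.
Proof. by rewrite /tail big_geq// subr0. Qed.

Lemma tailS p j : tail p j = p j.+1 + tail p j.+1.
Proof. by rewrite /tail [in RHS]big_nat_recr//=; ring. Qed.

(* Mass of the [k]-th dyadic cell of level [n], seen from [j] steps after the
   last renewal, when the current gap has law [p] and exceeds [j], and the later
   gaps have law [f]. *)
Fixpoint cell f p j n k : R :=
  if n is n'.+1 then
    if (k < 2 ^ n')%N then cell f p j.+1 n' k
    else p j.+1 * cell f f 0 n' (k - 2 ^ n')
  else tail p j.

Lemma cell_ge0 f p j n k : gap_law f -> gap_law p -> 0 <= cell f p j n k.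
Proof.
move=> f_law; elim: n p j k => [|n IH] p j k [p_ge0 tp_ge0] //=.
by case: ifP => _; [exact: IH | apply: mulr_ge0 => //; exact: IH].
Qed.

Lemma tail_le1 p j : gap_law p -> tail p j <= 1.
Proof. by move=> [p_ge0 _]; rewrite lerBlDr lerDl sumr_ge0. Qed.

Lemma tail_leS p j : gap_law p -> tail p j.+1 <= tail p j.
Proof. by move=> [p_ge0 _]; rewrite (tailS p j) lerDr. Qed.

Lemma gap_le_tail p j : gap_law p -> p j.+1 <= tail p j.
Proof. by move=> [_ tp_ge0]; rewrite (tailS p j) lerDl. Qed.

(** Every cell is part of the event that the current gap exceeds [j]. *)
Lemma cell_le_tail f p j n k :
  gap_law f -> gap_law p -> cell f p j n k <= tail p j.
Proof.
move=> f_law; elim: n p j k => [|n IH] p j k p_law //=.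
case: ifP => _; first by rewrite (le_trans (IH _ _ _ p_law))// tail_leS.
rewrite (le_trans _ (gap_le_tail j p_law))// ler_piMr ?p_law.1//.
by rewrite (le_trans (IH _ _ _ f_law)) ?tail_le1.
Qed.

Lemma cell_le1 f p j n k : gap_law f -> gap_law p -> cell f p j n k <= 1.
Proof.
by move=> f_law p_law; rewrite (le_trans (cell_le_tail _ _ _ _ _))// tail_le1.
Qed.

Lemma cell_gt0 f p j n k : (forall i, (0 < i)%N -> 0 < f i) ->
  (forall i, (0 < i)%N -> 0 < p i) ->
  (forall i, 0 < tail f i) -> (forall i, 0 < tail p i) ->
  0 < cell f p j n k.
Proof.
move=> f_gt0 + tf_gt0; elim: n p j k => [|n IH] p j k p_gt0 tp_gt0 //=.
case: ifP => _; first exact: IH.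
by rewrite mulr_gt0 ?p_gt0// IH.
Qed.

(** Index 1 is the word of [n] zeros followed by a one, which completes a gap of length j + n +
    1. *)
Lemma cell_S1 f p j n : cell f p j n.+1 1 = p (j + n.+1)%N.
Proof.
elim: n j => [|n IH] j; first by rewrite /= tail0 mulr1 addn1.
by rewrite -[LHS]/(if (1 < 2 ^ n.+1)%N then cell f p j.+1 n.+1 1 else _)
  -{1}(exp1n n.+1) ltn_exp2r// IH addSnnS.
Qed.

(** The word is a one, [n] zeros and a one, with gaps 1 and n + 1. It isolates the single value
    [f n.+1]. *)
Lemma cell_double_renewal f p n :
  cell f p 0 n.+2 (2 ^ n.+1 + 1) = p 1%N * f n.+1.
Proof. rewrite -[LHS]/(if (2 ^ n.+1 + 1 < 2 ^ n.+1)%N then cell f p 1 n.+1 _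
  else p 1%N * cell f f 0 n.+1 (2 ^ n.+1 + 1 - 2 ^ n.+1)).
by rewrite ltnNge leq_addr addKn cell_S1. Qed.

Lemma tail_geometric p : (forall i, (0 < i)%N -> p i = 2 ^- i) ->
  forall j, tail p j = 2 ^- j.
Proof.
move=> p_geo; elim=> [|j IH]; first by rewrite tail0 expr0 invr1.
have := tailS p j; rewrite IH p_geo// exprS invfM => E.
by apply: (addrI (2^-1 * 2 ^- j)); rewrite -E; lra.
Qed.

Lemma cell_geometric f p j n k : (forall i, (0 < i)%N -> f i = 2 ^- i) ->
  (forall i, (0 < i)%N -> p i = 2 ^- i) -> cell f p j n k = 2 ^- (j + n).
Proof.
move=> f_geo; elim: n p j k => [|n IH] p j k p_geo /=.
  by rewrite tail_geometric// addn0.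
case: ifP => _; first by rewrite IH// addSnnS.
by rewrite p_geo// IH// -invfM -exprD addSnnS.
Qed.

(** * Decay of the largest cell mass *)

(** Either the current gap ends by step [L], which costs a factor at most [c] and leaves at least
    [n0] digits for the bound [C], or the word keeps the gap open beyond [L], which has probability
    at most [tail p L]. *)
Lemma cell_le_max f p c C n0 L j n k :
  gap_law f -> gap_law p -> 0 <= c -> (forall i, (0 < i)%N -> p i <= c) ->
  (forall n k, (n0 <= n)%N -> cell f f 0 n k <= C) ->
  (j <= L)%N -> (n0 + (L - j) <= n)%N ->
  cell f p j n k <= Num.max (c * C) (tail p L).
Proof.
move=> f_law p_law c_ge0 p_le fC jL.
elim: n j k jL => [|n IH] j k jL nL.
  have -> : j = L by lia.
  by rewrite le_max lexx orbT.
have [->|jL'] := eqVneq j L; first by rewrite le_max cell_le_tail ?orbT.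
rewrite /=; case: ifP => _; first by apply: IH; lia.
rewrite le_max; apply/orP; left; apply: ler_pM; rewrite ?p_law.1 ?cell_ge0//.
  exact: p_le.
by apply: fC; lia.
Qed.

(** Iterating [cell_le_max], every further block of [L] digits gains a factor [c]; the tail term
    survives because c <= 1. *)
Lemma cell_le_expr f c L m n k :
  gap_law f -> 0 <= c -> (forall i, (0 < i)%N -> f i <= c) ->
  c <= 1 -> (m * L <= n)%N -> cell f f 0 n k <= Num.max (c ^+ m) (tail f L).
Proof.
move=> f_law c_ge0 f_le c_le1; elim: m n k => [|m IH] n k mn.
  by rewrite expr0 le_max cell_le1.
apply: (le_trans (cell_le_max k f_law f_law c_ge0 f_le IH (leq0n L) _)).
  by rewrite subn0 addnC -mulSn.
rewrite ge_max le_max [X in _ && X]le_max lexx orbT andbT.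
have [h|h] := leP (c ^+ m) (tail f L).
  by rewrite (_ : c * tail f L <= tail f L) ?orbT// ler_piMl// f_law.2.
by rewrite exprS lexx.
Qed.

Lemma cell_cvg0 f p e : gap_law f -> gap_law p ->
  tail f @ \oo --> (0 : R) -> tail p @ \oo --> (0 : R) ->
  (forall i, (0 < i)%N -> f i != 1) -> 0 < e ->
  exists n0, forall n k, (n0 <= n)%N -> cell f p 0 n k <= e.
Proof.
move=> f_law p_law tf0 tp0 f_neq1 e_gt0.
have tail_small q : tail q @ \oo --> (0 : R) -> forall r, 0 < r ->
    exists L, forall l, (L <= l)%N -> tail q l <= r.
  move=> q0 r r_gt0; have /cvgrPdist_le /(_ _ r_gt0) [L _ HL] := q0.
  exists L => l Ll; have := HL l Ll.
  by rewrite /= sub0r normrN; apply: le_trans; exact: ler_norm.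
have f_le1 i : (0 < i)%N -> f i <= 1.
  by case: i => // i _; rewrite (le_trans (gap_le_tail i f_law))// tail_le1.
(* Beyond [K] the values of [f] are at most 1/2, and the finitely many others are below 1, so their
   maximum with 1/2 serves as [c]. *)
have [c [c_ge0 c_lt1 f_le]] :
    exists c, [/\ 0 <= c, c < 1 & forall i, (0 < i)%N -> f i <= c].
  have [K HK] := tail_small _ tf0 2^-1 ltac:(by []).
  pose c := \big[Num.max/2^-1]_(1 <= i < K.+1) f i.
  have c_ge : 2^-1 <= c by exact: bigmax_ge_id.
  exists c; split; first by rewrite (le_trans _ c_ge).
    rewrite /c big_seq; elim/big_ind: _ => [|x y x1 y1|i]; first by lra.
      by rewrite gt_max x1.
    rewrite mem_index_iota => /andP[i_gt0 _].
    by rewrite lt_neqAle f_neq1 ?f_le1.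
  case=> // i _; have [iK|Ki] := ltnP i K.
    by apply: le_bigmax_seq => //; rewrite mem_index_iota.
  by rewrite (le_trans (gap_le_tail i f_law))// (le_trans (HK _ Ki)).
have [L HL] := tail_small _ tf0 _ e_gt0.
have [L' HL'] := tail_small _ tp0 _ e_gt0.
have [m cm] : exists m, c ^+ m <= e.
  have /cvgrPdist_le /(_ _ e_gt0) [m _ Hm] :
      c ^+ n @[n --> \oo] --> (0 : R) by apply: cvg_expr; rewrite ger0_norm.
  exists m; have := Hm m (leqnn m).
  by rewrite /= sub0r normrN; apply: le_trans; exact: ler_norm.
have fe n k : (m * L <= n)%N -> cell f f 0 n k <= e.
  move=> mn; apply: (le_trans (cell_le_expr k f_law c_ge0 f_le (ltW c_lt1) mn)).
  by rewrite ge_max cm HL.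
(* The [L'] digits are for the first gap, of law [p], bounded with the constant 1; the [m * L]
   digits are for the later gaps. *)
exists (m * L + L')%N => n k mn.
have p_le1 i : (0 < i)%N -> p i <= 1.
  by case: i => // i _; rewrite (le_trans (gap_le_tail i p_law))// tail_le1.
apply: (le_trans (cell_le_max k f_law p_law ler01 p_le1 fe (leq0n L') _)).
  by rewrite subn0.
by rewrite mul1r ge_max lexx HL'.
Qed.

(* Hellinger affinity with Lebesgue measure; the factor [2 ^- j] makes its
   recursion free of constants. *)
Definition affinity f p j n : R :=
  \sum_(0 <= k < 2 ^ n) Num.sqrt (2 ^- (j + n) * cell f p j n k).

Lemma affinity_ge0 f p j n : 0 <= affinity f p j n.
Proof. by apply: sumr_ge0 => k _; exact: sqrtr_ge0. Qed.

(** Split on the first digit: 0 lengthens the current gap, 1 completes it, and then both the mass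
    and the power of 2 factor. *)
Lemma affinityS f p j n : gap_law f -> gap_law p ->
  affinity f p j n.+1 = affinity f p j.+1 n +
    Num.sqrt (2 ^- j.+1 * p j.+1) * affinity f f 0 n.
Proof.
move=> f_law p_law.
rewrite /affinity (big_cat_nat (n := (2 ^ n)%N))/= ?leq_exp2l//.
congr (_ + _).
  by apply: eq_big_nat => k /andP[_ kn]; rewrite kn addSnnS.
rewrite -{1}[(2 ^ n)%N]add0n big_addn expnS mul2n -addnn addnK mulr_sumr.
apply: eq_bigr => k _; rewrite ltnNge leq_addl/= addnK -sqrtrM.
  by congr (Num.sqrt _); rewrite add0n -addSnnS exprD invfM; ring.
by rewrite mulr_ge0 ?invr_ge0 ?exprn_ge0// p_law.1.
Qed.

Local Notation r := (Num.sqrt 2^-1 : R).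

Lemma sqrt_expV2 n : Num.sqrt (2 ^- n : R) = r ^+ n.
Proof.
elim: n => [|n IH]; first by rewrite !expr0 invr1 sqrtr1.
by rewrite !exprS invfM sqrtrM ?invr_ge0// IH.
Qed.

Lemma sqrtV2_bounds : 0 <= r < 1.
Proof.
by rewrite sqrtr_ge0/= -[ltRHS](@sqrtr1 R) ltr_sqrt//; lra.
Qed.

Lemma sum_sqrtV2_le j N : \sum_(0 <= i < N) r ^+ (j + i) <= (1 - r)^-1.
Proof.
have /andP[r_ge0 r_lt1] := sqrtV2_bounds.
apply: (@le_trans _ _ (\sum_(0 <= i < N) r ^+ i)).
  apply: ler_sum => i _; rewrite exprD ler_piMl ?exprn_ge0//.
  by rewrite exprn_ile1// ltW.
have := subrX1 r N; rewrite big_mkord => E.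
rewrite -[leRHS]mul1r ler_pdivlMr ?subr_gt0//.
have -> : (\sum_(i < N) r ^+ i) * (1 - r) = 1 - r ^+ N.
  by rewrite -[LHS]opprK -mulrN opprB mulrC -E opprB.
by rewrite gerBl exprn_ge0.
Qed.

(** Unrolling [affinityS] up to the first one: words of zeros give the powers of [r], the others a
    convolution over the length of the first gap. Summed over levels, the convolution is at most the
    product of the two sums. *)
Lemma affinity_sum_le f p j N C : gap_law f -> gap_law p ->
  (forall M, (M <= N)%N -> \sum_(0 <= n < M) affinity f f 0 n <= C) ->
  \sum_(0 <= n < N) affinity f p j n <= \sum_(0 <= i < N) r ^+ (j + i) +
    (\sum_(0 <= i < N) Num.sqrt (2 ^- (j + i).+1 * p (j + i).+1)) * C.
Proof.
move=> f_law p_law; elim: N j => [|N IH] j SC.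
  by rewrite !big_geq// mul0r addr0.
rewrite !(big_nat_recl N)//=.
rewrite (eq_bigr _ (fun n _ => affinityS j n f_law p_law)) big_split/=.
rewrite -mulr_sumr.
have := IH j.+1 (fun M MN => SC M (leqW MN)).
have /(ler_wpM2l (sqrtr_ge0 (2 ^- j.+1 * p j.+1))) := SC N (leqnSn N).
have : affinity f p j 0 <= r ^+ (j + 0).
  rewrite /affinity expn0 big_nat1 addn0 -sqrt_expV2 ler_wsqrtr// ler_piMr//.
  exact: tail_le1.
rewrite addn0 mulrDl.
under [X in _ -> _ -> _ <= X + _ -> _]eq_bigr do rewrite addSnnS.
under [X in _ -> _ -> _ <= _ + X * _ -> _]eq_bigr do rewrite addSnnS.
lra.
Qed.

(* AM-GM, strict at an index where [f] differs from the geometric law. *)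
Lemma affinity_gap_lt1 f k0 : gap_law f -> (0 < k0)%N -> f k0 != 2 ^- k0 ->
  exists2 G : R, G < 1 &
    forall N, \sum_(0 <= i < N) Num.sqrt (2 ^- i.+1 * f i.+1) <= G.
Proof.
move=> f_law; case: k0 => // k0 _ f_neq.
pose u i : R := Num.sqrt (2 ^- i.+1); pose v i := Num.sqrt (f i.+1).
have ve i : v i ^+ 2 = f i.+1 by rewrite sqr_sqrtr// f_law.1.
have ue i : u i ^+ 2 = 2 ^- i.+1 by rewrite sqr_sqrtr// invr_ge0 exprn_ge0.
have gE i : Num.sqrt (2 ^- i.+1 * f i.+1) = u i * v i.
  by rewrite sqrtrM// invr_ge0 exprn_ge0.
(* From 2uv = u^2 + v^2 - (u - v)^2, where the sums of u^2 and v^2 are at most 1. *)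
exists (1 - (u k0 - v k0) ^+ 2 / 2).
  rewrite gtrBl divr_gt0// lt_neqAle sqr_ge0 andbT eq_sym sqrf_eq0 subr_eq0.
  by apply: contra f_neq => /eqP E; rewrite -ue -ve E.
(* The range is extended so that it contains the index [k0] of strict inequality. *)
move=> N; apply: (@le_trans _ _ (\sum_(0 <= i < N + k0.+1) u i * v i)).
  rewrite [leRHS](big_cat_nat (n := N))//= ?leq_addr//.
  rewrite (eq_bigr _ (fun i _ => gE i)) lerDl sumr_ge0// => i _.
  by rewrite mulr_ge0 ?sqrtr_ge0.
set M := (N + k0.+1)%N.
have : \sum_(0 <= i < M) (u i - v i) ^+ 2 =
    \sum_(0 <= i < M) u i ^+ 2 + \sum_(0 <= i < M) v i ^+ 2 -
    2 * \sum_(0 <= i < M) u i * v i.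
  rewrite mulr_sumr -sumrN -!big_split/=; apply: eq_bigr => i _; ring.
have : (u k0 - v k0) ^+ 2 <= \sum_(0 <= i < M) (u i - v i) ^+ 2.
  have kM : (k0 < M)%N by rewrite /M; lia.
  rewrite big_mkord (bigD1 (Ordinal kM))//= lerDl sumr_ge0// => *.
  exact: sqr_ge0.
have : \sum_(0 <= i < M) v i ^+ 2 <= 1.
  rewrite (eq_bigr _ (fun i _ => ve i)).
  by have := f_law.2 M; rewrite /tail subr_ge0 big_add1.
have : \sum_(0 <= i < M) u i ^+ 2 <= 1.
  rewrite (eq_bigr _ (fun i _ => ue i)).
  suff -> : \sum_(0 <= i < M) 2 ^- i.+1 = 1 - 2 ^- M :> R.
    by rewrite gerBl invr_ge0 exprn_ge0.
  elim: M => [|m IH]; first by rewrite big_geq// expr0 invr1 subrr.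
  by rewrite big_nat_recr//= IH exprS invfM; lra.
lra.
Qed.

(** For [f] itself the partial sums satisfy S <= B + G S, and G < 1 bounds them; one more
    decomposition at the first one passes from [f] to [p]. *)
Lemma affinity_summable f p k0 : gap_law f -> gap_law p ->
  (0 < k0)%N -> f k0 != 2 ^- k0 ->
  exists C, forall N, \sum_(0 <= n < N) affinity f p 0 n <= C.
Proof.
move=> f_law p_law k0_gt0 f_neq.
have [G G_lt1 GE] := affinity_gap_lt1 f_law k0_gt0 f_neq.
have mono (M N : nat) : (M <= N)%N ->
    \sum_(0 <= n < M) affinity f f 0 n <= \sum_(0 <= n < N) affinity f f 0 n.
  move=> MN; rewrite [leRHS](big_cat_nat (n := M))//= lerDl sumr_ge0// => *.
  exact: affinity_ge0.
pose B : R := (1 - r)^-1.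
have fC N : \sum_(0 <= n < N) affinity f f 0 n <= B / (1 - G).
  have := affinity_sum_le 0 f_law f_law (fun M => mono M N).
  have := sum_sqrtV2_le 0 N; rewrite -/B => le_B.
  set S := \sum_(0 <= n < N) affinity f f 0 n => le_S.
  have S_ge0 : 0 <= S by rewrite sumr_ge0// => *; exact: affinity_ge0.
  rewrite ler_pdivlMr ?subr_gt0//.
  have GE0 : \sum_(0 <= i < N) Num.sqrt (2 ^- (0 + i).+1 * f (0 + i).+1) <= G.
    exact: GE.
  have := ler_wpM2r S_ge0 GE0; lra.
exists (B + B * (B / (1 - G))) => N.
apply: (le_trans (affinity_sum_le 0 f_law p_law (fun M _ => fC M))).
have /andP[r_ge0 r_lt1] := sqrtV2_bounds.
have B_ge0 : 0 <= B by rewrite invr_ge0 subr_ge0 ltW.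
rewrite lerD ?sum_sqrtV2_le// ler_wpM2r// ?divr_ge0 ?subr_ge0 ?(ltW G_lt1)//.
apply: (le_trans _ (sum_sqrtV2_le 1 N)); apply: ler_sum => i _.
rewrite add0n add1n -sqrt_expV2 ler_wsqrtr// ler_piMr ?invr_ge0 ?exprn_ge0//.
by rewrite (le_trans (gap_le_tail i p_law))// tail_le1.
Qed.

End cells.

(** * Binary expansions along a renewal path *)

Section renewal_paths.
Context d (T : measurableType d) (R : realType) (Z : nat -> {mfun T >-> nat}).
Hypothesis Z_gt0 : forall n t, (0 < Z n t)%N.

(** The value at 0 is 0, which is not a renewal: the delay is thereby treated as the gap that
    follows time 0. *)
Definition renewal_time m t := (\sum_(0 <= i < m) Z i t)%N.

Lemma renewal_timeS m t : renewal_time m.+1 t = (renewal_time m t + Z m t)%N.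
Proof. by rewrite /renewal_time big_nat_recr. Qed.

Lemma leq_renewal_time m n t :
  (m <= n)%N -> (renewal_time m t <= renewal_time n t)%N.
Proof.
move=> mn; rewrite /renewal_time (big_cat_nat (n := m) (p := n))//=.
exact: leq_addr.
Qed.

(** Renewal times strictly increase, so a time after the first [m] gaps and within the next one is a
    renewal only at the end of that gap. *)
Lemma renewal_digit_gap m j t : (j < Z m t)%N ->
  renewal_digit R Z (renewal_time m t + j.+1) t = (Z m t == j.+1)%:R.
Proof.
move=> jZ; rewrite /renewal_digit indicE; congr (nat_of_bool _)%:R.
apply/idP/eqP => [|Zj]; last first.
  by rewrite inE; exists m => //=; rewrite -Zj -renewal_timeS.
rewrite inE => -[k _]; rewrite -/(renewal_time k.+1 t) => E.
have [km|mk|km] := ltngtP k m.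
- have := leq_renewal_time t km; lia.
- have := leq_renewal_time t mk; rewrite renewal_timeS => h.
  have := leq_renewal_time t (leqnSn k.+1).
  have := renewal_timeS k t; have := Z_gt0 k t.
  have := leq_renewal_time t mk.
  move: E h; rewrite renewal_timeS; lia.
- by move: E; rewrite km renewal_timeS; lia.
Qed.

Lemma index_le_renewal_time m t : (m <= renewal_time m t)%N.
Proof.
elim: m => // m IH; rewrite renewal_timeS.
by have := Z_gt0 m t; lia.
Qed.

Lemma renewal_digit_bounds n t : 0 <= renewal_digit R Z n t <= 1.
Proof. by rewrite /renewal_digit indicE ler0n lern1 leq_b1. Qed.

Definition digit_sum s t : R :=
  \sum_(1 <= n < s.+1) renewal_digit R Z n t * 2 ^- n.

Lemma digit_sumS s t :
  digit_sum s.+1 t = digit_sum s t + renewal_digit R Z s.+1 t * 2 ^- s.+1.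
Proof. by rewrite /digit_sum big_nat_recr. Qed.

Lemma digit_sum_cvg t : digit_sum s t @[s --> \oo] --> renewal_number R Z t.
Proof. by have := @cvg_renewal_number _ _ R Z t; rewrite -cvg_shiftS. Qed.

(* The binary digits of [shifted s] are those of [renewal_number] after rank
   [s]. *)
Definition shifted s t : R := 2 ^+ s * (renewal_number R Z t - digit_sum s t).

Lemma shifted0 t : shifted 0 t = renewal_number R Z t.
Proof. by rewrite /shifted /digit_sum big_geq// subr0 expr0 mul1r. Qed.

Lemma shiftedS s t :
  shifted s.+1 t = 2 * shifted s t - renewal_digit R Z s.+1 t.
Proof.
rewrite /shifted digit_sumS opprD addrA mulrBr [X in _ - X]mulrCA divff.
  by rewrite mulr1 exprS mulrA.
by rewrite expf_eq0/= pnatr_eq0.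
Qed.

(** A one always occurs after rank [s]. Strictness removes the ambiguity of dyadic expansions: the
    first digits determine the cell, taken open on the left and closed on the right. *)
Lemma shifted_gt0 s t : 0 < shifted s t.
Proof.
rewrite /shifted mulr_gt0 ?exprn_gt0// subr_gt0.
pose N := renewal_time s.+1 t.
have sN : (s < N)%N by exact: index_le_renewal_time.
have homo : {homo digit_sum ^~ t : a b / (a <= b)%N >-> a <= b}.
  apply/nondecreasing_seqP => n; rewrite digit_sumS lerDl.
  by have /andP[d0 _] := renewal_digit_bounds n.+1 t; rewrite mulr_ge0.
apply: (@lt_le_trans _ _ (digit_sum N t)).
  rewrite -(ltn_predK sN) digit_sumS (ltn_predK sN).
  have -> : renewal_digit R Z N t = 1.
    have Zs := Z_gt0 s t.
    rewrite /N renewal_timeS -(prednK Zs) renewal_digit_gap ?prednK//.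
    by rewrite eqxx.
  apply: (@le_lt_trans _ _ (digit_sum N.-1 t)).
    by apply: homo; rewrite -ltnS (ltn_predK sN).
  by rewrite ltrDl mul1r invr_gt0 exprn_gt0.
rewrite -(cvg_lim _ (@digit_sum_cvg t))//; apply: nondecreasing_cvgn_le => //.
by apply/cvg_ex; exists (renewal_number R Z t); exact: digit_sum_cvg.
Qed.

Lemma shifted_le1 s t : shifted s t <= 1.
Proof.
rewrite /shifted mulrC -ler_pdivlMr ?exprn_gt0// mul1r lerBlDl.
rewrite -(cvg_lim _ (@digit_sum_cvg t))//; apply: limr_le.
  by apply/cvg_ex; exists (renewal_number R Z t); exact: digit_sum_cvg.
(* The upper estimates [digit_sum n t + 2 ^- n] do not increase with [n]. *)
suff le n : digit_sum n t + 2 ^- n <= digit_sum s t + 2 ^- s \/ (n < s)%N.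
  near=> n; have [h|] := le n; last first.
    by rewrite ltnNge; have -> // : (s <= n)%N by near: n; exact: nbhs_infty_ge.
  by rewrite (le_trans _ h)// lerDl invr_ge0 exprn_ge0.
have [sn|] := leqP s n; [left|by right].
rewrite -(subnKC sn); elim: (n - s)%N => [|m IH]; first by rewrite addn0.
apply: le_trans IH; rewrite addnS digit_sumS exprS invfM.
have /andP[_ d1] := renewal_digit_bounds (s + m).+1 t.
have : 0 < 2 ^- (s + m) :> R by rewrite invr_gt0 exprn_gt0.
by nra.
Unshelve. all: by end_near. Qed.

(** The zeros of the gap only halve, and its last digit adds the 1. *)
Lemma shifted_renewal m t :
  shifted (renewal_time m t) t =
  2 ^- Z m t * (1 + shifted (renewal_time m.+1 t) t).
Proof.
have aux j : (j < Z m t)%N ->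
    shifted (renewal_time m t) t = 2 ^- j * shifted (renewal_time m t + j) t.
  elim: j => [|j IH] jZ; first by rewrite expr0 invr1 mul1r addn0.
  rewrite IH; last exact: ltnW.
  rewrite addnS shiftedS -addnS renewal_digit_gap; last exact: ltnW.
  rewrite gtn_eqF//.
  by rewrite exprS invfM subr0 mulrACA mulVf ?mul1r ?pnatr_eq0.
have Zm := Z_gt0 m t; rewrite (aux (Z m t).-1) ?prednK//.
rewrite renewal_timeS -{3 4}(prednK Zm) addnS shiftedS -addnS.
rewrite renewal_digit_gap ?prednK// eqxx subrKC.
have -> : 2 ^- Z m t = 2^-1 * 2 ^- (Z m t).-1 :> R.
  by rewrite -invfM -exprS prednK.
by rewrite mulrACA mulVf ?mul1r ?pnatr_eq0.
Qed.

End renewal_paths.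

(** * The law of the renewal number *)

Section renewal_law.
Context d (T : measurableType d) (R : realType) (P : probability T R).
Variable Z : nat -> {RV P >-> nat}.
Hypothesis Z_gt0 : forall n t, (0 < Z n t)%N.

Lemma probabilityE A : measurable A -> P A = (fine (P A))%:E.
Proof. by move=> mA; rewrite fineK// fin_num_measure. Qed.

Lemma measurable_gap m (A : set nat) : measurable (Z m @^-1` A).
Proof. by rewrite -[X in measurable X]setTI; exact: measurable_funP. Qed.

Definition gap m n : R := fine (P (Z m @^-1` [set n])).

Lemma gapE m n : P (Z m @^-1` [set n]) = (gap m n)%:E.
Proof. by rewrite probabilityE//; exact: measurable_gap. Qed.

Lemma tail_gap m j : P (Z m @^-1` [set n | (j < n)%N]) = (tail (gap m) j)%:E.
Proof.
elim: j => [|j IH].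
  rewrite tail0 -(@probability_setT _ _ _ P); congr (P _).
  by apply/seteqP; split => // t _; exact: Z_gt0.
have : P (Z m @^-1` [set n | (j < n)%N]) =
    (P (Z m @^-1` [set j.+1]) + P (Z m @^-1` [set n | (j.+1 < n)%N]))%E.
  rewrite -measureU; [|exact: measurable_gap..|].
    congr (P _); apply/seteqP; split => t /=.
      by rewrite leq_eqVlt => /orP[/eqP<-|]; [left|right].
    by case=> [->//|]; exact: ltnW.
  by apply/seteqP; split => // t [] /= ->; rewrite ltnn.
rewrite IH gapE (probabilityE (measurable_gap m [set n | (j.+1 < n)%N])).
by rewrite tailS -EFinD => -[/addrI ->].
Qed.

Lemma gap_law_gap m : gap_law (gap m).
Proof.
split=> n; first exact: fine_ge0.
by rewrite -lee_fin -tail_gap.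
Qed.

Lemma tail_gap_cvg0 m : tail (gap m) @ \oo --> (0 : R).
Proof.
have : P (Z m @^-1` [set n | (j < n)%N]) @[j --> \oo] -->
    P (\bigcap_j (Z m @^-1` [set n | (j < n)%N])).
  apply: nonincreasing_cvg_mu => //.
  - by rewrite ltey_eq fin_num_measure//; exact: measurable_gap.
  - by move=> j; exact: measurable_gap.
  - by apply: bigcap_measurable => [|j _]; [exists 0%N|exact: measurable_gap].
  - by move=> i j ij; apply/subsetPset => t /=; exact: leq_ltn_trans.
rewrite (_ : \bigcap_j _ = set0) ?measure0; last first.
  by apply/seteqP; split => // t /(_ (Z m t) I) /=; rewrite ltnn.
under eq_fun do rewrite tail_gap.
by move/fine_cvgP => [].
Qed.

Hypothesis Z_indep : mutually_independent Z.

(** Independence in the form used below: past gaps are prescribed, and the current one is only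
    restricted to a set. *)
Lemma probability_prefix m (z : nat -> nat) (A : set nat) :
  P [set t | (forall i, (i < m)%N -> Z i t = z i) /\ A (Z m t)] =
  ((\prod_(0 <= i < m) gap i (z i))%:E * P (Z m @^-1` A))%E.
Proof.
pose B i := if (i < m)%N then [set z i] else A.
pose J := [fset i in iota 0 m.+1].
have inJ i : (i \in J) = (i < m.+1)%N by rewrite in_fset mem_iota.
have := Z_indep J (fun i => I : measurable (B i)).
rewrite (_ : \bigcap_(i in _) _ =
    [set t | (forall i, (i < m)%N -> Z i t = z i) /\ A (Z m t)]); last first.
  apply/seteqP; split => t /=.
    move=> H; split.
      by move=> i im; have := H i; rewrite /= inJ /B im; apply; exact: ltnW.
    by have := H m; rewrite /= inJ /B ltnn; apply.
  move=> [H1 H2] i /=; rewrite inJ ltnS leq_eqVlt /B.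
  by case: eqVneq => [->|_ /= im]; rewrite ?ltnn// im; exact: H1.
move=> ->; rewrite (perm_big (index_iota 0 m.+1)); last first.
  apply: uniq_perm; [exact: fset_uniq|exact: iota_uniq|].
  by move=> i; rewrite inJ mem_index_iota.
rewrite big_nat_recr//= -prodEFin.
congr (_ * _)%E; last by rewrite /B ltnn.
by apply: eq_big_nat => i /andP[_ im]; rewrite /B im gapE.
Qed.

Hypothesis Z_ident :
  forall n, (0 < n)%N -> identically_distributed (Z n) (Z 1%N).

Lemma gap_ident m : (0 < m)%N -> gap m = gap 1.
Proof. by move=> m0; apply/funext => n; congr fine; exact: (Z_ident m0). Qed.

Let X := shifted R Z.

(** Induction on the word, one digit at a time. Keeping the past gaps [z] inside the event replaces
    conditional probabilities, which could be undefined on null pasts. *)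
Lemma probability_cell m z j n k : (k < 2 ^ n)%N ->
  P [set t | [/\ forall i, (i < m)%N -> Z i t = z i, (j < Z m t)%N &
    k%:R * 2 ^- n < X (\sum_(0 <= i < m) z i + j) t <= k.+1%:R * 2 ^- n]] =
  ((\prod_(0 <= i < m) gap i (z i)) * cell (gap 1) (gap m) j n k)%:E.
Proof.
elim: n m z j k => [|n IH] m z j k kn.
  move: kn; rewrite expn0 ltnS leqn0 => /eqP->.
  rewrite /= EFinM -tail_gap -probability_prefix; congr (P _).
  apply/seteqP; split => t /=; first by case.
  move=> [zt jt]; split => //.
  by rewrite expr0 invr1 mul0r mul1r shifted_gt0// shifted_le1.
have timeE t : (forall i, (i < m)%N -> Z i t = z i) ->
    (\sum_(0 <= i < m) z i)%N = renewal_time Z m t.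
  by move=> zt; apply: eq_big_nat => i /andP[_ /zt->].
have half (a : R) : a * 2 ^- n.+1 = a * 2 ^- n / 2.
  by rewrite exprS invfM; ring.
have ev_gt0 : 0 < 2 ^- n :> R by rewrite invr_gt0 exprn_gt0.
have e_gt0 : 0 < 2 ^+ n :> R by rewrite exprn_gt0.
have kE : (k%:R * 2 ^- n <= 1 :> R) = (k <= 2 ^ n)%N.
  by rewrite ler_pdivrMr// mul1r -natrX ler_nat.
have kSE : (k.+1%:R * 2 ^- n <= 1 :> R) = (k < 2 ^ n)%N.
  by rewrite ler_pdivrMr// mul1r -natrX ler_nat.
rewrite [cell _ _ _ _ _]/=; case: ifPn => k2.
  (* Digit 0: a renewal at this time would put [X] above 1/2, outside the cell. *)
  rewrite -IH//; congr (P _); apply/seteqP; split => t /=.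
    move=> [zt jt]; rewrite (timeE _ zt) !half => /andP[kX Xk].
    have := shiftedS R Z (renewal_time Z m t + j) t.
    rewrite -addnS renewal_digit_gap// -/X.
    have := shifted_gt0 R Z_gt0 (renewal_time Z m t + j.+1) t; rewrite -/X.
    have k1 : k.+1%:R * 2 ^- n <= 1 :> R by rewrite kSE.
    case: eqP => [_|Zj] X0; rewrite ?mulr1n ?mulr0n => XE; first lra.
    split=> //; first by rewrite ltn_neqAle jt andbT eq_sym; apply/eqP.
    by apply/andP; split; lra.
  move=> [zt jt]; rewrite (timeE _ zt) !half => /andP[kX Xk].
  have := shiftedS R Z (renewal_time Z m t + j) t.
  rewrite -addnS renewal_digit_gap// -/X; last exact: ltnW.
  rewrite gtn_eqF// mulr0n => XE; split=> //; first exact: ltnW.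
  by apply/andP; split; lra.
(* Digit 1: the current gap equals [j.+1] and joins the prefix. Without a renewal [X] would be at
   most 1/2, outside the cell. *)
pose z' i := if i == m then j.+1 else z i.
have z'm i : (i < m)%N -> z' i = z i by move=> im; rewrite /z' ltn_eqF.
have z'mm : z' m = j.+1 by rewrite /z' eqxx.
have k2' : (2 ^ n <= k)%N by rewrite leqNgt.
have kB : (k - 2 ^ n)%:R * 2 ^- n = k%:R * 2 ^- n - 1 :> R.
  by rewrite natrB// natrX mulrBl divff// gt_eqF.
have kBS : (k - 2 ^ n).+1%:R * 2 ^- n = k.+1%:R * 2 ^- n - 1 :> R.
  by rewrite -[(k - 2 ^ n).+1%:R]natr1 -[k.+1%:R]natr1 !mulrDl kB; ring.
have kn2 : (k - 2 ^ n < 2 ^ n)%N by rewrite ltn_subLR// addnn -mul2n -expnS.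
have := IH m.+1 z' 0%N (k - 2 ^ n)%N kn2.
rewrite !big_nat_recr//= (gap_ident (ltn0Sn m)) z'mm mulrA.
rewrite (eq_big_nat _ _ (fun i im => congr1 (gap i) (z'm i (andP im).2))) => <-.
  congr (P _); apply/seteqP; split => t /=.
    move=> [zt jt]; rewrite (timeE _ zt) !half => /andP[kX Xk].
    have := shiftedS R Z (renewal_time Z m t + j) t.
    rewrite -addnS renewal_digit_gap// -/X.
    have := shifted_le1 R Z (renewal_time Z m t + j.+1) t; rewrite -/X.
    have k1 : 1 <= k%:R * 2 ^- n :> R.
      by rewrite ler_pdivlMr// mul1r -natrX ler_nat.
    case: eqP => [Zj|_] X1; rewrite ?mulr1n ?mulr0n => XE; last lra.
    split=> //.
      move=> i; rewrite ltnS leq_eqVlt => /orP[/eqP->|im].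
        by rewrite z'mm.
      by rewrite z'm// zt.
    rewrite (eq_big_nat _ _ (fun i im => z'm i (andP im).2)) (timeE _ zt) addn0.
    by rewrite kB kBS; apply/andP; split; lra.
  move=> [zt' _].
  have zt i : (i < m)%N -> Z i t = z i by move=> im; rewrite zt' 1?ltnW// z'm.
  have Zj : Z m t = j.+1 by rewrite zt'// z'mm.
  rewrite (eq_big_nat _ _ (fun i im => z'm i (andP im).2)) (timeE _ zt) addn0.
  rewrite kB kBS !half => /andP[kX Xk].
  have := shiftedS R Z (renewal_time Z m t + j) t.
  rewrite -addnS renewal_digit_gap ?Zj// eqxx mulr1n -/X => XE.
  by split=> //; apply/andP; split; lra.
Qed.

Lemma renewal_cdf_le0 x : x <= 0 -> renewal_cdf Z x = 0.
Proof.
move=> x0; rewrite /renewal_cdf /cdf /distribution /pushforward.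
rewrite (_ : _ @^-1` _ = set0) ?measure0//.
apply/seteqP; split => // t /=; rewrite in_itv/= -shifted0 => Xx.
by have := shifted_gt0 R Z_gt0 0 t; rewrite ltNge (le_trans Xx).
Qed.

Lemma renewal_cdf_ge1 x : 1 <= x -> renewal_cdf Z x = 1.
Proof.
move=> x1; rewrite /renewal_cdf /cdf /distribution /pushforward.
rewrite (_ : _ @^-1` _ = setT) ?probability_setT//.
apply/seteqP; split => // t _ /=; rewrite in_itv/= -shifted0.
exact: le_trans (shifted_le1 R Z 0 t) x1.
Qed.

Lemma renewal_cdf_homo : {homo renewal_cdf Z : x y / x <= y}.
Proof.
move=> x y xy; rewrite /renewal_cdf fine_le ?fin_num_measure//.
exact: cdf_nondecreasing.
Qed.

Lemma renewal_cdfB x y : x <= y ->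
  renewal_cdf Z y - renewal_cdf Z x =
  fine (P [set t | x < renewal_number R Z t <= y]).
Proof.
move=> xy; have mX (A : set R) :
    measurable A -> measurable (renewal_number R Z @^-1` A).
  move=> mA; rewrite -[X in measurable X]setTI.
  exact: measurable_renewal_number.
rewrite /renewal_cdf /cdf /distribution /pushforward.
set A := _ @^-1` `]-oo, y]; set B := _ @^-1` `]-oo, x]; set D := [set t | _].
have -> : D = renewal_number R Z @^-1` `]x, y].
  by apply/seteqP; split => t /=; rewrite in_itv.
have -> : A = (B `|` renewal_number R Z @^-1` `]x, y])%classic.
  apply/seteqP; split => t; rewrite /A /B /= !in_itv/=.
    by move=> ->; case: leP; [left|right].
  by case=> [/le_trans->//|/andP[]].
rewrite measureU; [|exact: mX..|].
  have mBC := (mX _ (measurable_itv `]-oo, x]), mX _ (measurable_itv `]x, y])).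
  rewrite fineD; [|exact: fin_num_measure mBC.1|exact: fin_num_measure mBC.2].
  by rewrite [X in X - _]addrC addrK.
apply/seteqP; split => // t [] /=; rewrite /B /= !in_itv/= => h /andP[].
by rewrite ltNge h.
Qed.

Lemma renewal_increment n k : (k < 2 ^ n)%N ->
  dyadic_increment (renewal_cdf Z) n k = cell (gap 1) (gap 0) 0 n k.
Proof.
move=> kn; rewrite /dyadic_increment renewal_cdfB; last first.
  by rewrite ler_wpM2r ?invr_ge0 ?exprn_ge0// ler_nat.
have := @probability_cell 0 (fun=> 0%N) 0 n k kn.
rewrite !big_geq// mul1r => E.
rewrite -[RHS]/(fine (_%:E)) -E; congr (fine (P _)).
apply/seteqP; split => t /=; rewrite /X shifted0//.
by case.
Qed.

End renewal_law.

(** * The stationary delay and its normalisation *)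

Section stationary_renewal.
Context d (T : measurableType d) (R : realType) (P : probability T R).
Variables (Z : nat -> {RV P >-> nat}) (mu : R).
Hypothesis Z_gt0 : forall n t, (0 < Z n t)%N.
Hypothesis Z0_law : forall n, (0 < n)%N ->
  P [set t | Z 0%N t = n] = (P [set t | (n <= Z 1%N t)%N] * mu^-1%:E)%E.

Lemma gap0S n : gap Z 0 n.+1 = tail (gap Z 1) n / mu.
Proof. by apply: EFin_inj; rewrite -gapE EFinM -tail_gap//; exact: Z0_law. Qed.

(** The tail is constant from [n0] on and tends to 0. Such normalisations of the delay law are what
    determine [mu] below. *)
Lemma tail_gap0_eq0 n0 : (forall n, (n0 <= n)%N -> gap Z 0 n.+1 = 0) ->
  tail (gap Z 0) n0 = 0.
Proof.
move=> gap0_eq0.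
have tailE n : (n0 <= n)%N -> tail (gap Z 0) n = tail (gap Z 0) n0.
  elim: n => [|n IH]; first by rewrite leqn0 => /eqP->.
  rewrite leq_eqVlt => /orP[/eqP->//|n0n].
  by rewrite -IH// [in RHS]tailS gap0_eq0// add0r.
apply: (cvg_unique (@norm_hausdorff _ R^o) (F := tail (gap Z 0) @ \oo)).
  apply: cvg_near_cst; near=> n; apply: tailE; near: n.
  exact: nbhs_infty_ge.
exact: tail_gap_cvg0.
Unshelve. all: by end_near. Qed.

Lemma muV_gt0 : 0 < mu^-1.
Proof.
rewrite ltNge; apply/negP => mu_le0.
have : tail (gap Z 0) 0 = 0.
  apply: tail_gap0_eq0 => n _.
  apply/eqP; rewrite eq_le (gap_law_gap Z_gt0 0).1 gap0S andbT.
  by rewrite mulr_ge0_le0// (gap_law_gap Z_gt0 1).2.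
by rewrite tail0 => /eqP; rewrite oner_eq0.
Qed.

(** The tail of the delay is 2^-j (2/mu) + (1 - 2/mu); its limit 0 forces mu = 2. *)
Lemma gap0_geometric : (forall n, (0 < n)%N -> gap Z 1 n = 2 ^- n) ->
  forall n, (0 < n)%N -> gap Z 0 n = 2 ^- n.
Proof.
move=> geo1.
have gap0E n : gap Z 0 n.+1 = 2 ^- n / mu by rewrite gap0S tail_geometric.
have tailE j : tail (gap Z 0) j = 2 ^- j * (2 / mu) + (1 - 2 / mu).
  elim: j => [|j IH]; first by rewrite tail0 expr0 invr1; lra.
  by have := tailS (gap Z 0) j; rewrite IH gap0E exprS invfM; lra.
suff muE : 2 / mu = 1.
  have muV : mu^-1 = 2^-1 by lra.
  by case=> // n _; rewrite gap0E exprS invfM muV mulrC.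
have : tail (gap Z 0) j @[j --> \oo] --> (0 * (2 / mu) + (1 - 2 / mu) : R).
  under eq_fun do rewrite tailE.
  apply: cvgD; last exact: cvg_cst.
  apply: cvgMl; under eq_fun do rewrite -exprVn.
  by apply: cvg_expr; rewrite ger0_norm; lra.
move=> /(cvg_unique (@norm_hausdorff _ R^o) (tail_gap_cvg0 Z_gt0 0)).
lra.
Qed.

(** * Constant gaps and the uniform law on [k] points *)

Section degenerate.
Variable k : nat.
Hypothesis k_gt0 : (0 < k)%N.
Hypothesis gap1_k : gap Z 1 k = 1.

Lemma tail_degenerate j : tail (gap Z 1) j = (j < k)%:R.
Proof.
have [g_ge0 t_ge0] := gap_law_gap Z_gt0 1.
have mono i j' : (i <= j')%N -> tail (gap Z 1) j' <= tail (gap Z 1) i.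
  move=> ij; rewrite -(subnKC ij); elim: (j' - i)%N => [|n IH].
    by rewrite addn0.
  by rewrite addnS (le_trans _ IH)// tail_leS//; exact: gap_law_gap.
have tk := tailS (gap Z 1) k.-1; rewrite prednK// gap1_k in tk.
have := tail_le1 k.-1 (gap_law_gap Z_gt0 1).
have := t_ge0 k; have := t_ge0 j; have := tail_le1 j (gap_law_gap Z_gt0 1).
case: ltnP => [jk|/mono kj].
  have /mono : (j <= k.-1)%N by rewrite -ltnS prednK.
  by rewrite mulr1n; lra.
by rewrite mulr0n; lra.
Qed.

(** The delay has mass 1/mu at each of 1, ..., k and none beyond, so mu = k. *)
Lemma gap0_degenerate l : (0 < l)%N -> gap Z 0 l = (l <= k)%:R / k%:R.
Proof.
have gap0E n : gap Z 0 n.+1 = (n < k)%:R / mu.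
  by rewrite gap0S tail_degenerate.
suff muE : k%:R / mu = 1.
  have mu0 : mu != 0 by rewrite -invr_eq0 gt_eqF ?muV_gt0.
  case: l => // l _; rewrite gap0E; congr (_ / _).
  by move: muE => /(congr1 ( *%R^~ mu)); rewrite divfK// mul1r.
have tailE j : (j <= k)%N -> tail (gap Z 0) j = 1 - j%:R / mu.
  elim: j => [|j IH] jk; first by rewrite tail0 mul0r subr0.
  have := tailS (gap Z 0) j; rewrite IH ?(ltnW jk)// gap0E jk -natr1.
  by rewrite mulr1n; lra.
have : tail (gap Z 0) k = 0.
  by apply: tail_gap0_eq0 => n kn; rewrite gap0E ltnNge kn/= mul0r.
by rewrite tailE// => /eqP; rewrite subr_eq0 => /eqP.
Qed.

Definition degenerate_value l : R := 2 ^- l / (1 - 2 ^- k).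

Lemma expVk_bounds : 0 < 2 ^- k :> R /\ 2 ^- k <= 2^-1 :> R.
Proof.
split; first by rewrite invr_gt0 exprn_gt0.
by rewrite lef_pV2 ?posrE ?exprn_gt0// -[leLHS]expr1 ler_weXn2l// ler1n.
Qed.

Lemma renewal_number_degenerate t : (forall i, Z i.+1 t = k) ->
  renewal_number R Z t = degenerate_value (Z 0%N t).
Proof.
move=> Zk; have [q_gt0 q_le] := expVk_bounds.
set q : R := 2 ^- k in q_gt0 q_le.
pose y m := shifted R Z (renewal_time Z m t) t.
have yE m : y m.+1 = q * (1 + y m.+2).
  by rewrite /y shifted_renewal// Zk.
have y_bounds m : 0 < y m <= 1 by rewrite shifted_gt0// shifted_le1.
(* The fixed point of y -> q(1 + y). The recursion [yE] contracts distances to [a] by q <= 1/2,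
   uniformly in [m], so every [y m.+1] equals [a]. *)
pose a := q / (1 - q).
have aE : a = q * (1 + a) by rewrite /a; field; lra.
have a_bounds : 0 <= a <= 1.
  apply/andP; split; first by rewrite divr_ge0//; lra.
  by rewrite ler_pdivrMr; lra.
have y1 : y 1%N = a.
  apply/eqP; rewrite -subr_eq0; apply/eqP/eq0_le_expV2 => n.
  suff: forall m, `|y m.+1 - a| <= 2 ^- n by [].
  elim: n => [|n IH] m.
    have /andP[y0 y1] := y_bounds m.+1; have /andP[a0 a1] := a_bounds.
    by rewrite expr0 invr1 ler_norml; apply/andP; split; lra.
  have -> : y m.+1 - a = q * (y m.+2 - a) by rewrite yE {1}aE; ring.
  by rewrite normrM gtr0_norm// exprS invfM ler_pM// ltW.
have := shifted_renewal R Z_gt0 0 t; rewrite -/(y 0%N) -/(y 1%N) y1.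
rewrite /y /renewal_time big_geq// shifted0 => ->.
by rewrite /degenerate_value -/q /a; move: (2 ^- Z 0%N t) => e; field; lra.
Qed.

Lemma probability_degenerate_value x :
  P (Z 0%N @^-1` [set l | (0 < l <= k)%N /\ degenerate_value l <= x]) =
  (\sum_(l <- iota 1 k | degenerate_value l <= x) k%:R^-1)%:E.
Proof.
suff H n : (n <= k)%N ->
    P (Z 0%N @^-1` [set l | (0 < l <= n)%N /\ degenerate_value l <= x]) =
    (\sum_(l <- index_iota 1 n.+1 | degenerate_value l <= x) k%:R^-1)%:E.
  by rewrite H// /index_iota subn1.
elim: n => [_|n IH nk].
  rewrite big_geq// (_ : _ @^-1` _ = set0) ?measure0//.
  apply/seteqP; split => // t /= [/andP[l_gt0]].
  by rewrite leqNgt l_gt0.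
rewrite big_mkcond/= big_nat_recr//= -big_mkcond/= EFinD -IH; last exact: ltnW.
have setE : [set l | (0 < l <= n.+1)%N /\ degenerate_value l <= x] =
    ([set l | (0 < l <= n)%N /\ degenerate_value l <= x] `|`
     (if (degenerate_value n.+1 <= x)%R then [set n.+1] else set0))%classic.
  apply/seteqP; split => l /=.
    move=> [/andP[l0]]; rewrite leq_eqVlt => /orP[/eqP->|ln] lx; last first.
      by left; rewrite l0.
    by rewrite lx; right.
  case=> [[/andP[-> ln]] ->|]; first by rewrite leqW.
  by case: ifPn => // nx /= ->; split => //; rewrite leqnn.
rewrite setE preimage_setU measureU; [|exact: measurable_gap..|].
  congr (_ + _)%E; case: ifP => _; last by rewrite preimage_set0 measure0.
  transitivity (gap Z 0 n.+1)%:E; first exact: gapE.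
  by rewrite gap0_degenerate// nk mul1r.
apply/seteqP; split => // t /= [[/andP[_ h] _]].
by case: ifP => // _ /= E; move: h; rewrite E ltnn.
Qed.

Lemma degenerate_value_inj : injective degenerate_value.
Proof.
have [q_gt0 q_le] := expVk_bounds.
move=> l l' /mulIf => /(_ _)/invr_inj h.
apply: (@ieexprIn R 2) => //; first by lra.
by apply: h; rewrite invr_eq0; lra.
Qed.

(** Since [degenerate_value] is injective, the cardinalities are lengths of duplicate-free lists of
    indices. *)
Lemma uniform_fset_cdf_degenerate x :
  uniform_fset_cdf [fset degenerate_value l | l in iota 1 k] x =
  \sum_(l <- iota 1 k | degenerate_value l <= x) k%:R^-1.
Proof.
have perm_value (s : seq nat) (A : {fset R}) : uniq s ->
    (forall y, (y \in A) = (y \in map degenerate_value s)) -> #|` A| = size s.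
  move=> s_uniq AE; rewrite -(size_map degenerate_value).
  apply/perm_size/uniq_perm; [exact: fset_uniq| |exact: AE].
  by rewrite map_inj_uniq//; exact: degenerate_value_inj.
rewrite /uniform_fset_cdf.
rewrite (perm_value [seq l <- iota 1 k | degenerate_value l <= x]).
- rewrite (perm_value (iota 1 k)) ?iota_uniq ?size_iota//; last first.
    by move=> y; apply/imfsetP/mapP.
  by rewrite big_const_seq iter_addr_0 size_filter mulr_natl.
- by rewrite filter_uniq// iota_uniq.
move=> y; rewrite in_fset/=; apply/andP/mapP.
  move=> [/imfsetP[l /= lk ->] lx]; exists l => //.
  by rewrite mem_filter lx.
move=> [l]; rewrite mem_filter => /andP[lx lk] ->; split => //.
by apply/imfsetP; exists l.
Qed.

Hypothesis Z_ident :
  forall n, (0 < n)%N -> identically_distributed (Z n) (Z 1%N).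

Lemma renewal_cdf_degenerate :
  renewal_cdf Z = uniform_fset_cdf [fset degenerate_value l | l in iota 1 k].
Proof.
apply/funext => x; rewrite uniform_fset_cdf_degenerate.
rewrite -[RHS]/(fine (_%:E)) -probability_degenerate_value; congr fine.
rewrite /cdf /distribution /pushforward.
set A := _ @^-1` _; set B := _ @^-1` _.
(* The exceptional null events: a delay larger than [k], or a later gap different from [k]. Off
   their union the events [A] and [B] agree. *)
pose N0 i := Z i @^-1` (if i is 0%N then [set l | (k < l)%N] else ~` [set k]).
have mN0 i : measurable (N0 i) by exact: measurable_gap.
have N00 i : P (N0 i) = 0%E.
  case: i => [|i]; rewrite /N0.
    rewrite tail_gap// tail_gap0_eq0// => n kn.
    by rewrite gap0_degenerate// ltnNge kn mul0r.
  rewrite -preimage_setC probability_setC; last exact: measurable_gap.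
  by rewrite gapE gap_ident// gap1_k subee.
pose N := \bigcup_i N0 i.
have mN : measurable N by exact: bigcup_measurable.
have N_null : P N = 0%E.
  apply: measure_negligible => //; apply: negligible_bigcup => i.
  by exists (N0 i); split => //; exact: N00.
have mA : measurable A.
  by rewrite -[X in measurable X]setTI; exact: measurable_renewal_number.
have mB : measurable B by exact: measurable_gap.
have ABN t : ~ N t -> A t <-> B t.
  move=> nN.
  have Zk i : Z i.+1 t = k.
    by apply: contrapT => Zi; apply: nN; exists i.+1.
  have Z0k : (0 < Z 0 t <= k)%N.
    by rewrite Z_gt0 leqNgt; apply/negP => h; apply: nN; exists 0%N.
  rewrite /A /B /= in_itv/= renewal_number_degenerate//.
  by split => [h|[]].
apply/eqP; rewrite eq_le; apply/andP; split.
  rewrite -(measureU0 mB mN N_null) le_measure ?inE//; first exact: measurableU.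
  by move=> t At; have [Nt|/ABN h] := pselect (N t); [right|left; exact/h].
rewrite -(measureU0 mA mN N_null) le_measure ?inE//; first exact: measurableU.
by move=> t Bt; have [Nt|/ABN h] := pselect (N t); [right|left; exact/h].
Qed.

End degenerate.
End stationary_renewal.

Theorem theorem4p1 (d : measure_display) (T : measurableType d) (R : realType)
    (P : probability T R) (Z : nat -> {RV P >-> nat}) (mu : R)
    (Z_gt0 : forall n t, (0 < Z n t)%N)
    (Z_indep : mutually_independent Z)
    (Z_ident : forall n, (0 < n)%N -> identically_distributed (Z n) (Z 1%N))
    (Z1_mean : 'E_P[fun t => (Z 1%N t)%:R]%E = mu%:E)
    (Z0_law : forall n, (0 < n)%N ->
      P [set t | Z 0%N t = n] = (P [set t | (n <= Z 1%N t)%N] * mu^-1%:E)%E) :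
  let F := renewal_cdf Z in
  let degenerate_at (k : nat) := P [set t | Z 1%N t = k] = 1%E in
  [/\ (geometric_mean2 (Z 1%N) -> F = @uniform01_cdf R),
      (forall k, (0 < k)%N -> degenerate_at k ->
        F = uniform_fset_cdf
              [fset (2 ^- l / (1 - 2 ^- k) : R) | l in iota 1 k]),
      (~ geometric_mean2 (Z 1%N) ->
       ~ (exists2 k, (0 < k)%N & degenerate_at k) ->
        singular_continuous F)
    & {in `[0, 1] &, {homo F : x y / x < y}} <->
      (forall n, (0 < n)%N -> (0 < P [set t | Z 1%N t = n])%E)].
Proof.
move=> F degenerate_at.
have F_homo := @renewal_cdf_homo _ _ _ P Z.
have F_le0 := renewal_cdf_le0 Z_gt0.
have F_ge1 := @renewal_cdf_ge1 _ _ _ P Z.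
have incE := renewal_increment Z_gt0 Z_indep Z_ident.
have law i := gap_law_gap Z_gt0 i.
have muV_gt0 := muV_gt0 Z_gt0 Z0_law.
split.
- move=> geo.
  have geo1 n : (0 < n)%N -> gap Z 1 n = 2 ^- n.
    by move=> n0; apply: EFin_inj; rewrite -gapE geo.
  apply: uniform_of_increments => // n k kn; rewrite incE//.
  by rewrite cell_geometric//; exact: gap0_geometric Z0_law geo1.
- move=> k k_gt0 degk; apply: (renewal_cdf_degenerate Z_gt0 Z0_law) => //.
  by apply: EFin_inj; rewrite -gapE.
- move=> not_geo not_deg; split.
    have [k0 [k0_gt0 k0_neq]] : exists k, (0 < k)%N /\ gap Z 1 k != 2 ^- k.
      apply: contrapT => no; apply: not_geo => n n_gt0; rewrite gapE.
      congr EFin; apply: contrapT => n_neq; apply: no.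
      by exists n; split=> //; exact/eqP.
    have [C sumC] := affinity_summable (law 1%N) (law 0%N) k0_gt0 k0_neq.
    apply: (singular_of_increments F_homo F_le0 F_ge1) => N.
    apply: le_trans (sumC N); rewrite le_eqVlt; apply/orP; left; apply/eqP.
    apply: eq_bigr => n _; apply: eq_big_nat => k /andP[_ kn].
    by rewrite incE.
  apply: (continuous_of_increments F_homo F_le0 F_ge1) => e e_gt0.
  have [] := @cell_cvg0 _ (gap Z 1) (gap Z 0) e (law 1%N) (law 0%N)
    (tail_gap_cvg0 Z_gt0 1) (tail_gap_cvg0 Z_gt0 0) _ e_gt0.
    move=> i i_gt0; apply/eqP => gi; apply: not_deg; exists i => //.
    by rewrite /degenerate_at gapE gi.
  by move=> n0 Hn0; exists n0 => k kn; rewrite incE// Hn0.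
- split=> [F_inc [//|n] _|gap_gt0].
    (* Strict increase makes the mass of the word with gaps 1 and n + 1 positive, hence also its
       factor [gap Z 1 n.+1]. *)
    have kn : (2 ^ n.+1 + 1 < 2 ^ n.+2)%N.
      rewrite [ltnRHS]expnS mul2n -addnn ltn_add2l.
      by rewrite -[X in (X < _)%N](expn0 2) ltn_exp2l.
    have := incE _ _ kn; rewrite cell_double_renewal.
    rewrite /dyadic_increment => cE.
    have in01 k : (k <= 2 ^ n.+2)%N ->
        (k%:R * 2 ^- n.+2 : R) \in `[0, 1].
      move=> kn'; rewrite in_itv/= mulr_ge0 ?invr_ge0 ?exprn_ge0//=.
      by rewrite ler_pdivrMr ?exprn_gt0// mul1r -natrX ler_nat.
    have : 0 < gap Z 0 1 * gap Z 1 n.+1.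
      rewrite -cE subr_gt0; apply: F_inc.
      + by apply: in01; exact: ltnW.
      + exact: in01.
      + by rewrite ltr_pM2r ?invr_gt0 ?exprn_gt0// ltr_nat.
    rewrite gapE lte_fin [in X in _ -> X]lt_neqAle (law 1%N).1 andbT eq_sym.
    by apply: contraTN => /eqP ->; rewrite mulr0 ltxx.
  have gap1_gt0 n : (0 < n)%N -> 0 < gap Z 1 n.
    by move=> n0; rewrite -lte_fin -gapE gap_gt0.
  have tail_gt0 i : (forall n, (0 < n)%N -> 0 < gap Z i n) ->
      forall j, 0 < tail (gap Z i) j.
    move=> g j; rewrite (tailS (gap Z i) j) ltr_wpDr// ?g//.
    exact: (law i).2.
  (* Stationarity transfers positivity to the delay, whose masses are tails of the gap law divided
     by [mu]. *)
  have gap0_gt0 n : (0 < n)%N -> 0 < gap Z 0 n.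
    case: n => // n _; rewrite (gap0S Z_gt0 Z0_law) mulr_gt0//.
    exact: tail_gt0.
  apply: (increasing_of_increments F_homo) => n k kn.
  rewrite incE// cell_gt0//; exact: tail_gt0.
Qed.
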